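(* Let $G=\langle x,y\rangle$ be a metabelian $2$-group of maximal class and of order $|G|=2^m$, where $m\ge 3$. Suppose that the generators are selected such that $x\in G\setminus\chi_2(G)$ if $m\ge 4$, $y\in\chi_2(G)\setminus\gamma_2(G)$, and that the relations $$x^2=s_{m-1}^w,\qquad y^2s_2=s_{m-1}^z$$ are satisfied with exponents $0\le w,z\le 1$. Let the maximal normal subgroups of $G$ be ordered by $M_1=\langle y,\gamma_2(G)\rangle$, $M_2=\langle x,\gamma_2(G)\rangle$, $M_3=\langle xy,\gamma_2(G)\rangle$, and let $\mathrm{V}_i:G/\gamma_2(G)\to M_i/\gamma_2(M_i)$ be the transfer from $G$ to $M_i$ for $1\le i\le 3$. Then for all $0\le j,\ell\le 1$, $$\mathrm{V}_1(x^jy^\ell\gamma_2(G))=s_{m-1}^{wj+z\ell}\cdot 1,$$ $$\mathrm{V}_2(x^jy^\ell\gamma_2(G))=s_{m-1}^{wj+z\ell}s_2^{-(j+\ell)}\gamma_3(G)=\begin{cases}s_2^{(w-1)j+(z-1)\ell}\cdot 1,&\text{if }m=3,\\ s_2^{-(j+\ell)}\gamma_3(G),&\text{if }m\ge 4,\end{cases}$$ $$\mathrm{V}_3(x^jy^\ell\gamma_2(G))=s_{m-1}^{wj+z\ell}s_2^{-\ell}\gamma_3(G)=\begin{cases}s_2^{wj+(z-1)\ell}\cdot 1,&\text{if }m=3,\\ s_2^{-\ell}\gamma_3(G),&\text{if }m\ge 4.\end{cases}$$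
   Context: Conventions: $[a,b]=a^{-1}b^{-1}ab$, $a^b=b^{-1}ab$. The lower central series is $\gamma_1(G)=G$, $\gamma_j(G)=[\gamma_{j-1}(G),G]$ for $j\ge 2$. A $2$-group of order $2^m$ is of maximal class if its nilpotency class is $m-1$; then $G/\gamma_2(G)$ is of type $(2,2)$. Metabelian means that $\gamma_2(G)$ is abelian. $\chi_2(G)=\{g\in G\mid [g,u]\in\gamma_4(G)\text{ for all }u\in\gamma_2(G)\}$; it contains $\gamma_2(G)$ and equals $G$ if and only if $m=3$. Commutators: $s_2=[y,x]$ and $s_j=[s_{j-1},x]$ for $j\ge 3$. The commutator groups of the maximal subgroups are $\gamma_2(M_1)=1$ and $\gamma_2(M_2)=\gamma_2(M_3)=\gamma_3(G)$. The transfer is the usual transfer homomorphism; here it is given by $g\gamma_2(G)\mapsto g^2\gamma_2(M_i)$ if $g\in G\setminus M_i$, and $g\gamma_2(G)\mapsto g\cdot g^h\gamma_2(M_i)$ if $g\in M_i$, with any fixed $h\in G\setminus M_i$. *)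

(* Defs.v *)
From HB Require Import structures.
From mathcomp Require Import all_boot all_order all_algebra.
From mathcomp Require Import all_fingroup all_solvable.

Set Implicit Arguments.
Unset Strict Implicit.
Unset Printing Implicit Defensive.

Local Open Scope group_scope.

(* The lower central series gamma_j(G) is 'L_j(G), whose indexing starts at 1
   as on paper; the commutator [~ a, b] and the conjugate a ^ b are also the
   paper's, namely a^-1 * b^-1 * a * b and b^-1 * a * b. *)

Definition expgz (gT : finGroupType) (g : gT) (k : int) : gT :=
  match k with
  | Posz n => g ^+ n
  | Negz n => g ^- n.+1
  end.

Definition chi2 (gT : finGroupType) (G : {set gT}) : {set gT} :=
  [set g in G | [forall u in 'L_2(G), [~ g, u] \in 'L_4(G)]].

(* s_2 = [y, x] and s_j = [s_(j-1), x] for j >= 3; only meaningful for j >= 2. *)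
Definition main_comm (gT : finGroupType) (x y : gT) (j : nat) : gT :=
  iter (j - 2) (fun s => [~ s, x]) [~ y, x].

Definition adjoin_lcn2 (gT : finGroupType) (G : {group gT}) (g : gT) :
    {group gT} :=
  <<g |: 'L_2(G)>>%G.

Section TransferAbelianization.

Variable gT : finGroupType.
Implicit Types G H : {group gT}.

Definition abelianization H : {morphism H >-> coset_of 'L_2(H)} :=
  [morphism of restrm (lcn_norm 2 H) (coset 'L_2(H))].

Lemma abelianization_abelian H : abelian (abelianization H @* H).
Proof.
rewrite /= morphim_restrm setIid -[_ @* _]/(H / 'L_2(H)).
exact: der_abelian 0 H.
Qed.

Variables G H : {group gT}.

(* [transfer] takes its values in an additive copy of the abelianization of H,
   which fmval maps back to cosets of 'L_2(H).  H is meant to be a subgroup of G,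
   but the construction does not need this. *)
Definition transfer_elt (g : gT) : coset_of 'L_2(H) :=
  FiniteModule.fmval (transfer G (abelianization_abelian H) g).

Lemma transfer_eltM : {in G &, {morph transfer_elt : g h / g * h}}.
Proof. by move=> g h Gg Gh; rewrite /transfer_elt transferM. Qed.

Canonical transfer_elt_morphism := Morphism transfer_eltM.

Lemma transfer_elt_ker :
  'ker (abelianization G) \subset 'ker transfer_elt_morphism.
Proof.
rewrite ker_restrm ker_coset (setIidPr (lcn_sub 2 G)) gen_subG.
apply/subsetP=> _ /imset2P[g h Gg Gh ->]; apply/kerP; first exact: groupR.
have addC a b :
    transfer_elt a * transfer_elt b = transfer_elt b * transfer_elt a.
  by rewrite /transfer_elt -!FiniteModule.fmvalA GRing.addrC.
apply/(mulgI (transfer_elt (h * g))).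
by rewrite mulg1 -transfer_eltM ?groupM ?groupV // -commgC !transfer_eltM //
           addC.
Qed.

(* V : G / gamma_2(G) -> H / gamma_2(H). *)
Definition V_transfer : coset_of 'L_2(G) -> coset_of 'L_2(H) :=
  factm transfer_elt_ker (subxx G).

Lemma V_transferE g :
  g \in G -> V_transfer (coset 'L_2(G) g) = transfer_elt g.
Proof. exact: (factmE transfer_elt_ker (subxx G)). Qed.

End TransferAbelianization.

Arguments V_transfer {gT} G%_G H%_G _.

(* Main.v *)
(* The relations alone determine the structure of G.  The element s_(m-1) is
   central because gamma_m(G) = 1, so x ^ 2 is central and y ^ 2 = s_(m-1)^z s_2^-1
   commutes with y and with s_(m-1); hence x inverts s_2 and y centralises it.
   It follows that gamma_2(G) = <s_2>, gamma_3(G) = <s_2 ^ 2>, M_1 is abelian and,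
   since x and x y both invert s_2, gamma_2(M_2) = gamma_2(M_3) = gamma_3(G).
   Each M_i has index 2, for otherwise G would be cyclic by the Burnside basis
   theorem; so the transfer of g is the class of g ^ 2 if g is outside M_i and of
   g g^h = g ^ 2 [g, h] otherwise, and it suffices to evaluate it on x and y. *)

Require Import Defs.
From mathcomp Require Import all_boot all_order all_algebra.
From mathcomp Require Import all_fingroup all_solvable.
From mathcomp Require Import ring.

Set Implicit Arguments.
Unset Strict Implicit.
Unset Printing Implicit Defensive.

Local Open Scope group_scope.

(** * Transfer to a subgroup of index two *)

Lemma rcosets_index2 (gT : finGroupType) (G H : {group gT}) (h : gT) :
  H \subset G -> #|G : H| = 2 -> h \in G :\: H ->
  rcosets H G = [set (H : {set gT}); H :* h].
Proof.
move=> sHG iHG /setDP[Gh nHh].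
have neq : (H : {set gT}) != H :* h.
  by apply: contraNneq nHh => ->; apply: rcoset_refl.
apply/esym/eqP; rewrite eqEcard cards2 neq [X in X <= _]iHG leqnn andbT.
apply/subsetP=> _ /set2P[] ->; apply/rcosetsP; last by exists h.
by exists 1; rewrite ?group1 ?rcoset1.
Qed.

(** The two factors come from the cosets [H] and [H :* h]. The canonical representative of [H] is
    [1], but [t] is known only up to a left factor in [H], which has to cancel in every explicit
    formula. *)
Lemma transfer_elt_index2 (gT : finGroupType) (G H : {group gT}) (h g : gT)
    (c := coset 'L_2(H)) (t := repr (H :* h)) :
  H \subset G -> #|G : H| = 2 -> h \in G :\: H -> g \in G ->
  transfer_elt G H g =
    c (g * (repr (H :* g))^-1) * c (t * g * (repr (H :* h :* g))^-1).
Proof.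
move=> sHG iHG hGH Gg; have /setDP[Gh nHh] := hGH.
have reprM k : k \in G -> repr (H :* k) \in G.
  move=> Gk; have /rcosetP[u Hu ->] := mem_repr_rcoset H k.
  by rewrite groupM // (subsetP sHG).
have mem_step k : k \in G ->
    repr (H :* k) * g * (repr (H :* k :* g))^-1 \in H.
  move=> Gk; rewrite -rcosetM.
  have /rcosetP[u Hu ->] := mem_repr_rcoset H (k * g).
  have /rcosetP[v Hv ->] := mem_repr_rcoset H k.
  by rewrite -(mulgA v) invMg (mulgA (v * _)) mulgK groupM ?groupV.
have cK k : k \in G ->
    c (repr (H :* k) * g * (repr (H :* k :* g))^-1) \in abelianization H @* H.
  move=> /mem_step Hs; exact: (mem_morphim (abelianization H)).
rewrite /transfer_elt /transfer (rcosets_index2 sHG iHG hGH).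
rewrite big_setU1 ?big_set1 /=; last first.
  by rewrite inE; apply: contraNneq nHh => ->; apply: rcoset_refl.
rewrite FiniteModule.fmvalA; congr (_ * _); last by rewrite FiniteModule.fmodK ?cK.
have := cK 1 (group1 G); rewrite rcoset1 repr_group mul1g.
by move=> ?; rewrite FiniteModule.fmodK.
Qed.

Section Index2.
Variables (gT : finGroupType) (G H : {group gT}).
Hypotheses (sHG : H \subset G) (iHG : #|G : H| = 2).

Let nH k : k \in H -> k \in 'N('L_2(H)).
Proof. exact: (subsetP (lcn_norm 2 H)). Qed.

Lemma transfer_elt_out g :
  g \in G :\: H -> transfer_elt G H g = coset 'L_2(H) (g ^+ 2).
Proof.
move=> gGH; have /setDP[Gg nHg] := gGH.
rewrite (@transfer_elt_index2 _ _ _ g g) //.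
(* The representative of [H :* g] is [u * g], so the two factors become the classes of [u^-1] and
   [u * g ^+ 2], and [u] cancels. *)
have /rcosetP[u Hu ->] := mem_repr_rcoset H g.
have Hgg : g * g \in H.
  have : H :* (g * g) \in rcosets H G.
    by apply/rcosetsP; exists (g * g); rewrite ?groupM.
  rewrite (@rcosets_index2 _ _ _ g) // => /set2P[] e; first by rewrite -e rcoset_refl.
  by case/negP: nHg; rewrite -(mulgK g g) -mem_rcoset -e rcoset_refl.
rewrite -rcosetM (rcoset_id Hgg) repr_group invg1 mulg1 invMg mulgA mulgV mul1g.
by rewrite -mulgA -morphM ?nH ?groupV ?(groupM Hu) // mulKg.
Qed.

Lemma transfer_elt_in g h :
  h \in G :\: H -> g \in H ->
  transfer_elt G H g = coset 'L_2(H) (g * g ^ h).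
Proof.
move=> hGH Hg; have /setDP[Gh nHh] := hGH.
(* Describing the nontrivial coset by [h^-1] makes the second factor a conjugate of [g ^ h] by an
   element of [H], which has the same class modulo ['L_2(H)]. *)
have hVGH : h^-1 \in G :\: H by rewrite inE !groupV Gh nHh.
have nHG : H <| G by apply: index2_normal.
have Hgh : g ^ h \in H by rewrite memJ_norm // (subsetP (normal_norm nHG)).
rewrite (@transfer_elt_index2 _ _ _ h^-1 g) ?(subsetP sHG) //.
rewrite rcoset_id // repr_group invg1 mulg1.
have -> : H :* h^-1 :* g = H :* h^-1.
  rewrite -rcosetM; apply/rcoset_eqP.
  by rewrite mem_rcoset invgK -mulgA -[_ * _]conjgE.
have /rcosetP[u Hu ->] := mem_repr_rcoset H h^-1.
rewrite (_ : _ * _ * _ = (g ^ h) ^ u^-1); last first.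
  by rewrite !conjgE !invMg !invgK !mulgA.
move: (g ^ h) Hgh => k Hk.
have c1 : coset 'L_2(H) [~ k, u^-1] = 1.
  by apply/coset_id/mem_commg; rewrite ?groupV.
rewrite -morphM ?nH ?groupJ ?groupV //.
by rewrite conjg_mulR mulgA [LHS]morphM ?nH ?groupM ?groupV //= c1 mulg1.
Qed.
End Index2.

Lemma V_transferX (gT : finGroupType) (G H : {group gT}) (x y a b : gT)
    (j l : nat) :
  x \in G -> y \in G -> a \in H -> b \in H ->
  transfer_elt G H x = coset 'L_2(H) a ->
  transfer_elt G H y = coset 'L_2(H) b ->
  V_transfer G H (coset 'L_2(G) (x ^+ j * y ^+ l))
    = a ^+ j * b ^+ l *: 'L_2(H) :> {set gT}.
Proof.
move=> Gx Gy Ha Hb Vx Vy; have nH := subsetP (lcn_norm 2 H).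
rewrite V_transferE ?groupM ?groupX // transfer_eltM ?groupX //.
have VX k n : k \in G -> transfer_elt G H (k ^+ n) = transfer_elt G H k ^+ n.
  by move=> Gk; apply: (morphX (transfer_elt_morphism G H)).
rewrite !VX // Vx Vy -!morphX ?nH // -morphM ?nH ?groupX //.
(* As a set, a coset is a right coset; it is also a left coset because its representative normalises
   ['L_2(H)]. *)
by rewrite val_coset ?nH ?groupM ?groupX // norm_rlcoset ?nH ?groupM ?groupX.
Qed.

(** * Commutators of generated groups and the index of the maximal subgroups *)

(** Modulo [N] the images of [A] and [B] centralise each other, hence so do the groups they
    generate. *)
Lemma commg_gen_sub (gT : finGroupType) (A B : {set gT}) (N : {group gT}) :
  A \subset 'N(N) -> B \subset 'N(N) ->
  {in A & B, forall a b, [~ a, b] \in N} -> [~: <<A>>, <<B>>] \subset N.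
Proof.
move=> nA nB cAB; rewrite -quotient_cents2 ?gen_subG // !quotient_gen //.
rewrite cent_gen gen_subG; apply: quotient_cents2r; rewrite gen_subG.
by apply/subsetP=> _ /imset2P[a b Aa Bb ->]; apply: cAB.
Qed.

Lemma mem_main_comm (gT : finGroupType) (G : {group gT}) (x y : gT) (j : nat) :
  x \in G -> y \in G -> 1 < j -> main_comm x y j \in 'L_j(G).
Proof.
move=> Gx Gy; case: j => [|[|j]] // _; rewrite /main_comm subn2 /=.
by elim: j => [|j IHj]; rewrite ?mem_commg.
Qed.

(** The quotient by the adjoined subgroup is generated by the image of [a], whose square is trivial;
    so the index divides 2, and it is not 1 because [a] lies outside. *)
Lemma index_adjoin_lcn2 (gT : finGroupType) (G : {group gT}) (p : nat)
    (g a : gT) :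
  p.-group G -> ~~ abelian G -> G :=: <<[set g; a]>> -> a ^+ 2 \in 'L_2(G) ->
  [/\ adjoin_lcn2 G g \subset G, #|G : adjoin_lcn2 G g| = 2
    & a \in G :\: adjoin_lcn2 G g].
Proof.
move=> pG nabG defG a2; set M := adjoin_lcn2 G g.
have Gg : g \in G by rewrite defG mem_gen ?set21.
have Ga : a \in G by rewrite defG mem_gen ?set22.
have sMG : M \subset G by rewrite gen_subG subUset sub1set Gg lcn_sub.
have sLM : 'L_2(G) \subset M by rewrite sub_gen ?subsetUr.
have Mg : g \in M by rewrite mem_gen ?setU11.
have nMG : M <| G by apply: sub_der1_normal.
have nMa : a \in G :\: M.
  rewrite inE Ga andbT; apply: contra nabG => Ma.
  (* If M were G, then G = <g> since 'L_2(G) consists of non-generators. *)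
  have GM : G \subset M by rewrite defG gen_subG subUset !sub1set Mg.
  have sM : M \subset 'Phi(G) <*> [set g].
    rewrite gen_subG subUset joing_subr (Phi_joing pG).
    by rewrite (subset_trans _ (joing_subl _ _)) // joing_subl.
  have /Phi_nongen <- : 'Phi(G) <*> [set g] = G.
    apply/eqP; rewrite eqEsubset join_subG Phi_sub sub1set Gg /=.
    exact: subset_trans GM sM.
  exact: cycle_abelian.
split=> //; have nMGs := subsetP (normal_norm nMG).
rewrite -card_quotient ?normal_norm //; apply/prime_nt_dvdP => //.
  rewrite -trivg_card1 -subG1 quotient_sub1 ?normal_norm //.
  by apply: contraL nMa => /subsetP/(_ a Ga) Ma; rewrite inE Ma.
have sGa : G / M \subset <[coset M a]>.
  rewrite [X in X / _]defG quotient_gen ?subUset ?sub1set ?nMGs // gen_subG.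
  apply/subsetP=> _ /morphimP[k _ /set2P[] -> ->]; last exact: cycle_id.
  by rewrite /= coset_id ?group1.
apply: dvdn_trans (cardSg sGa) _; rewrite -orderE order_dvdn -morphX ?nMGs //.
by rewrite /= coset_id // (subsetP sLM).
Qed.

(** This links the integer exponents of the case [m = 3] to products of natural powers. *)
Lemma expgz_subn (gT : finGroupType) (g : gT) (k n : nat) :
  expgz g (k%:Z - n%:Z)%R = g ^+ k * g ^- n.
Proof.
have [le_nk | lt_kn] := leqP n k.
  by rewrite subzn //= -[in RHS](subnK le_nk) expgD mulgK.
(* With this [i] the difference [k - n] is exactly [Negz i]. *)
have [i ->] : exists i, n = (k + i.+1)%N.
  by exists (n - k).-1; rewrite prednK ?subn_gt0 // subnKC // ltnW.
by rewrite PoszD GRing.opprD GRing.addNKr -NegzE /= addnC expgD invMg mulKVg.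
Qed.

(** * Structure of [G] forced by the relations *)

Section Structure.

Variables (gT : finGroupType) (G : {group gT}) (x y : gT) (m w z : nat).
Hypotheses (m_ge3 : 3 <= m) (order_G : #|G| = (2 ^ m)%N).
Hypothesis maximal_class_G : nil_class G = (m - 1)%N.
Hypothesis generators : G :=: <<[set x; y]>>.
Local Notation s := [~ y, x].
Local Notation t := (main_comm x y (m - 1)).
Hypotheses (rel_x : x ^+ 2 = t ^+ w) (rel_y : y ^+ 2 * s = t ^+ z).

Let Gx : x \in G. Proof. by rewrite generators mem_gen ?set21. Qed.
Let Gy : y \in G. Proof. by rewrite generators mem_gen ?set22. Qed.
Let pG : 2.-group G. Proof. by rewrite /pgroup order_G pnatX. Qed.


Lemma lcn_order_log : 'L_m(G) = 1.
Proof.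
have mE : m = (m - 1).+1 by rewrite subn1 prednK ?(ltn_trans _ m_ge3).
have /lcn_nil_classP := pgroup_nil pG => /(_ (m - 1)).
by rewrite maximal_class_G leqnn -mE; move/elimT; apply.
Qed.

Lemma main_comm_last_central : t \in 'C(G).
Proof.
have m1 : 1 < m - 1 by rewrite ltn_subRL.
have mE : m = (m - 1).+1 by rewrite subn1 prednK ?(ltn_trans _ m_ge3).
apply/centP=> g Gg; apply/commgP; rewrite -in_set1 -[[set 1]]lcn_order_log mE.
case: (m - 1) m1 => [|k] // k1.
by rewrite mem_commg // mem_main_comm.
Qed.

(** Since [x ^+ 2] is a power of the central [t], expanding [[~ y, x ^+ 2] = 1] gives
    [s * s ^ x = 1]. *)
Lemma commg_conj_x : s ^ x = s^-1.
Proof.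
have /commgP : commute y (x ^+ 2).
  by rewrite rel_x; apply/commuteX/commute_sym/(centP main_comm_last_central).
rewrite expgS expg1 commgMJ => /eqP ss.
by apply/esym/eqP; rewrite eq_invg_mul ss.
Qed.

Lemma commg_commute_y : commute s y.
Proof.
have -> : s = y ^- 2 * t ^+ z by rewrite -rel_y mulKg.
apply/commute_sym/commuteM; first exact/commuteV/commuteX.
by apply/commuteX/commute_sym/(centP main_comm_last_central).
Qed.

Lemma commg_conj_y : s ^ y = s.
Proof. by rewrite conjgE commg_commute_y mulKg. Qed.

(** Each generator of [G] inverts or fixes [s]. The exponents 1 and 2 serve for the second and third
    terms of the lower central series. *)
Lemma norm_cycle_commgX k : G \subset 'N(<[s ^+ k]>).
Proof.
rewrite generators gen_subG subUset !sub1set !inE -!cycleJ !conjXg.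
by rewrite commg_conj_x commg_conj_y expgVn cycleV subxx.
Qed.

Lemma lcn2_cycle : 'L_2(G) = <[s]>.
Proof.
have nsG := norm_cycle_commgX 1; rewrite expg1 generators gen_subG in nsG.
apply/eqP; rewrite eqEsubset cycle_subG mem_commg // andbT.
rewrite [X in 'L_2(X)]generators commg_gen_sub //.
move=> a b /set2P[]-> /set2P[]->; rewrite ?commgg ?group1 ?cycle_id //.
by rewrite -invg_comm groupV cycle_id.
Qed.

Lemma lcn3_cycle : 'L_3(G) = <[s ^+ 2]>.
Proof.
have sx : [~ s, x] = s ^- 2 by rewrite commgEl commg_conj_x -invMg.
have sy : [~ s, y] = 1 by rewrite commgEl commg_conj_y mulVg.
have -> : 'L_3(G) = [~: <[s]>, G] by rewrite -lcn2_cycle.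
apply/eqP; rewrite eqEsubset cycle_subG -groupV -sx.
rewrite mem_commg ?cycle_id // andbT.
have nsG := norm_cycle_commgX 2.
have Gs : s \in G by rewrite groupR.
(* Unfolding the cycle exhibits both sides of the commutator as generated by sets, so only
   [[~ s, x]] and [[~ s, y]] have to be checked. *)
rewrite /cycle [X in [~: _, X]]generators.
rewrite commg_gen_sub ?sub1set ?(subsetP nsG) //.
  by rewrite subUset !sub1set !(subsetP nsG).
by move=> a b /set1P-> /set2P[]->; rewrite ?sx ?sy ?group1 // groupV cycle_id.
Qed.

Lemma adjoin_lcn2E g : adjoin_lcn2 G g = <<[set g; s]>>%G.
Proof.
apply/val_inj/eqP; rewrite /= lcn2_cycle eqEsubset !gen_subG !subUset !sub1set.
rewrite !mem_gen ?setU11 ?set21 //= ?inE ?cycle_id ?orbT // andbT cycle_subG.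
by rewrite mem_gen ?set22.
Qed.

(** The subgroup is generated by [g] and [s] alone, so [[~ s, g]] is, up to inversion, the only
    nontrivial commutator of generators. *)
Lemma lcn2_adjoin_lcn2 g (N : {group gT}) :
  g \in 'N(N) -> s \in 'N(N) -> [~ s, g] \in N ->
  'L_2(adjoin_lcn2 G g) \subset N.
Proof.
move=> Ng Ns Nsg; rewrite adjoin_lcn2E.
apply: commg_gen_sub; rewrite ?subUset ?sub1set ?Ng //.
move=> a b /set2P[]-> /set2P[]->; rewrite ?commgg ?group1 //.
by rewrite -invg_comm groupV.
Qed.

Lemma lcn2_adjoin_lcn2_inverting g :
  g \in G -> s ^ g = s^-1 -> 'L_2(adjoin_lcn2 G g) = 'L_3(G).
Proof.
move=> Gg sg; have sgE : [~ s, g] = s ^- 2 by rewrite commgEl sg -invMg.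
have nsG := subsetP (norm_cycle_commgX 2).
rewrite lcn3_cycle; apply/eqP; rewrite eqEsubset.
rewrite lcn2_adjoin_lcn2 ?sgE ?groupV ?cycle_id ?nsG //; last exact: groupR.
rewrite cycle_subG -groupV -sgE adjoin_lcn2E.
by rewrite mem_commg // mem_gen ?set21 ?set22.
Qed.

Lemma lcn2_adjoin_lcn2_y : 'L_2(adjoin_lcn2 G y) = 1.
Proof.
apply/eqP; rewrite -subG1 lcn2_adjoin_lcn2 ?norm1 ?inE //.
by rewrite commgEl commg_conj_y mulVg.
Qed.

End Structure.

(** * Evaluation of the three transfers *)

Theorem theorem2p3 (gT : finGroupType) (G : {group gT}) (x y : gT)
    (m w z : nat)
    (m_ge3 : 3 <= m)
    (metabelian_G : abelian 'L_2(G))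
    (order_G : #|G| = (2 ^ m)%N)
    (maximal_class_G : nil_class G = (m - 1)%N)
    (generators : G :=: <<[set x; y]>>)
    (x_notin_chi2 : 4 <= m -> x \notin chi2 G)
    (y_in_chi2 : y \in chi2 G :\: 'L_2(G))
    (w_le1 : w <= 1)
    (z_le1 : z <= 1)
    (rel_x : x ^+ 2 = main_comm x y (m - 1) ^+ w)
    (rel_y : y ^+ 2 * main_comm x y 2 = main_comm x y (m - 1) ^+ z)
    (j l : nat)
    (j_le1 : j <= 1)
    (l_le1 : l <= 1) :
  let s := main_comm x y in
  let V1 := V_transfer G (adjoin_lcn2 G y) in
  let V2 := V_transfer G (adjoin_lcn2 G x) in
  let V3 := V_transfer G (adjoin_lcn2 G (x * y)) in
  let c := coset 'L_2(G) (x ^+ j * y ^+ l) in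
  let A2 := s (m - 1)%N ^+ (w * j + z * l)%N * s 2 ^- (j + l)%N in
  let A3 := s (m - 1)%N ^+ (w * j + z * l)%N * s 2 ^- l in
  let e2 : int := ((w%:Z - 1) * j%:Z + (z%:Z - 1) * l%:Z)%R in
  let e3 : int := (w%:Z * j%:Z + (z%:Z - 1) * l%:Z)%R in
  [/\ V1 c = s (m - 1)%N ^+ (w * j + z * l)%N *: 1 :> {set gT},
      V2 c = A2 *: 'L_3(G) :> {set gT}
      /\ A2 *: 'L_3(G) = (if m == 3 then expgz (s 2) e2 *: 1
                          else s 2 ^- (j + l)%N *: 'L_3(G))
    & V3 c = A3 *: 'L_3(G) :> {set gT}
      /\ A3 *: 'L_3(G) = (if m == 3 then expgz (s 2) e3 *: 1
                          else s 2 ^- l *: 'L_3(G))].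
Proof.
move=> s V1 V2 V3 c A2 A3 e2 e3.
set r := s 2; set t := s (m - 1)%N.
have tC : t \in 'C(G) :=
  main_comm_last_central m_ge3 order_G maximal_class_G generators.
have rx : r ^ x = r^-1 :=
  commg_conj_x m_ge3 order_G maximal_class_G generators rel_x.
have ry : r ^ y = r :=
  commg_conj_y m_ge3 order_G maximal_class_G generators rel_y.
have L2E : 'L_2(G) = <[r]> :=
  lcn2_cycle m_ge3 order_G maximal_class_G generators rel_x rel_y.
have L3E : 'L_3(G) = <[r ^+ 2]> :=
  lcn3_cycle m_ge3 order_G maximal_class_G generators rel_x rel_y.
have L2M :=
  lcn2_adjoin_lcn2_inverting m_ge3 order_G maximal_class_G generators rel_x rel_y.
have L2M1 : 'L_2(adjoin_lcn2 G y) = 1 :=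
  lcn2_adjoin_lcn2_y m_ge3 order_G maximal_class_G generators rel_x rel_y.
have Gx : x \in G by rewrite generators mem_gen ?set21.
have Gy : y \in G by rewrite generators mem_gen ?set22.
have L2M2 : 'L_2(adjoin_lcn2 G x) = 'L_3(G) by apply: L2M.
have L2M3 : 'L_2(adjoin_lcn2 G (x * y)) = 'L_3(G).
  by apply: L2M; rewrite ?groupM // conjgM [_ ^ x]rx conjVg [_ ^ y]ry.
have pG : 2.-group G by rewrite /pgroup order_G pnatX.
have nabG : ~~ abelian G.
  by rewrite -nil_class1 maximal_class_G -ltnNge ltn_subRL.
have t2 : t \in 'L_2(G).
  have m1 : 1 < m - 1 by rewrite ltn_subRL.
  exact: subsetP (lcn_sub_leq G m1) _ (mem_main_comm Gx Gy m1).
have r2 : r \in 'L_2(G) by rewrite L2E cycle_id.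
have y2 : y ^+ 2 = t ^+ z * r^-1 by rewrite -rel_y mulgK.
have Lx2 : x ^+ 2 \in 'L_2(G) by rewrite rel_x groupX.
have Ly2 : y ^+ 2 \in 'L_2(G) by rewrite y2 groupM ?groupV ?groupX.
have index_M := index_adjoin_lcn2 pG nabG.
(* The generating pairs are chosen so that the second member is [x] or [y], whose square is known to
   lie in ['L_2(G)]. *)
have gen1 : G :=: <<[set y; x]>> by rewrite setUC.
have gen3 : G :=: <<[set x * y; y]>>.
  have genx : x \in <<[set x * y; y]>>.
    by rewrite -[X in X \in _](mulgK y) groupM ?groupV ?mem_gen ?set21 ?set22.
  apply/eqP; rewrite eqEsubset gen_subG subUset !sub1set groupM // Gy andbT.
  by rewrite generators gen_subG subUset !sub1set genx mem_gen ?set22.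
have [sM1 iM1 xM1] := index_M _ _ gen1 Lx2.
have [sM2 iM2 yM2] := index_M _ _ generators Ly2.
have [sM3 iM3 yM3] := index_M _ _ gen3 Ly2.
(* If [x] were in this subgroup, which contains [x * y], then so would be [y]. *)
have xM3 : x \in G :\: adjoin_lcn2 G (x * y).
  rewrite inE Gx andbT; apply: contraTN yM3 => M3x.
  by rewrite inE -(groupMl _ M3x) mem_gen ?setU11.
have sM g : 'L_2(G) \subset adjoin_lcn2 G g by rewrite sub_gen ?subsetUr.
have tr : commute t r by apply: (centP tC); rewrite groupR.
have trV k n : commute (t ^+ k) (r ^- n) by apply/commuteV/commuteX2.
have ts g k : t ^+ k \in adjoin_lcn2 G g.
  by rewrite groupX ?(subsetP (sM g)).
have rs g : r^-1 \in adjoin_lcn2 G g by rewrite groupV ?(subsetP (sM g)).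
have trs g k : t ^+ k * r^-1 \in adjoin_lcn2 G g by rewrite groupM.
have Mg g : g \in adjoin_lcn2 G g by rewrite mem_gen ?setU11.
have V1x : transfer_elt G (adjoin_lcn2 G y) x = coset _ (t ^+ w).
  by rewrite (transfer_elt_out sM1 iM1 xM1) rel_x.
have V1y : transfer_elt G (adjoin_lcn2 G y) y = coset _ (t ^+ z).
  (* Here [y * y ^ x = y ^+ 2 * [~ y, x]], the left side of the second relation. *)
  rewrite (transfer_elt_in sM1 iM1 xM1) //; congr coset.
  by rewrite conjg_mulR mulgA -rel_y.
have V2x : transfer_elt G (adjoin_lcn2 G x) x = coset _ (t ^+ w * r^-1).
  (* Here [x * x ^ y = x ^+ 2 * [~ x, y]], and [[~ x, y]] is [r^-1]. *)
  rewrite (transfer_elt_in sM2 iM2 yM2) //; congr coset.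
  by rewrite conjg_mulR mulgA -invg_comm -rel_x.
have V2y : transfer_elt G (adjoin_lcn2 G x) y = coset _ (t ^+ z * r^-1).
  by rewrite (transfer_elt_out sM2 iM2 yM2) y2.
have V3x : transfer_elt G (adjoin_lcn2 G (x * y)) x = coset _ (t ^+ w).
  by rewrite (transfer_elt_out sM3 iM3 xM3) rel_x.
have V3y : transfer_elt G (adjoin_lcn2 G (x * y)) y = coset _ (t ^+ z * r^-1).
  by rewrite (transfer_elt_out sM3 iM3 yM3) y2.
(* For [m > 3] the element [t] of ['L_(m - 1)(G)] already lies in ['L_3(G)]; commuting it to the
   right lets the coset absorb it. *)
have L3_absorb k n : 3 < m -> t ^+ k * r ^- n *: 'L_3(G) = r ^- n *: 'L_3(G).
  move=> m_gt3; have m1 : 2 < m - 1 by rewrite ltn_subRL.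
  have t3 : t \in 'L_3(G).
    by rewrite (subsetP (lcn_sub_leq G m1)) // mem_main_comm // ltnW.
  by rewrite (trV k n) lcosetM lcoset_id // groupX.
(* For [m = 3] instead, [t] coincides with [r] and ['L_3(G)] is trivial, so the powers merge into
   one integer power. *)
have quotE k n :
    t ^+ k * r ^- n *: 'L_3(G)
    = (if m == 3 then expgz r (k%:Z - n%:Z)%R *: 1 else r ^- n *: 'L_3(G)).
  case: eqP => [m3 | /eqP m_neq3]; last first.
    by rewrite L3_absorb // ltn_neqAle eq_sym m_neq3.
  have tE : t = r by rewrite /t m3.
  have L3 : 'L_3(G) = 1 by rewrite -m3 (lcn_order_log m_ge3 order_G).
  by rewrite L3 tE expgz_subn.
have e2E : e2 = ((w * j + z * l)%N%:Z - (j + l)%N%:Z)%R.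
  by rewrite /e2 !PoszD !PoszM; ring.
have e3E : e3 = ((w * j + z * l)%N%:Z - l%:Z)%R.
  by rewrite /e3 !PoszD !PoszM; ring.
split.
- by rewrite (V_transferX _ _ Gx Gy _ _ V1x V1y) // L2M1 -!expgM -expgD.
- split; last by rewrite /A2 e2E quotE.
  rewrite (V_transferX _ _ Gx Gy _ _ V2x V2y) // L2M2; congr (_ *: _).
  rewrite expgMn; last exact: (trV w 1%N).
  rewrite expgMn; last exact: (trV z 1%N).
  (* The factor [r ^- j] is moved past the power of [t] coming from [y], which collects all powers
     of [t] in front. *)
  rewrite !expgVn -!expgM -mulgA (mulgA (r ^- j)) -(trV _ j) !mulgA -expgD.
  by rewrite -mulgA -invMg -expgD [(l + j)%N]addnC.
- split; last by rewrite /A3 e3E quotE.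
  rewrite (V_transferX _ _ Gx Gy _ _ V3x V3y) // L2M3; congr (_ *: _).
  rewrite expgMn; last exact: (trV z 1%N).
  by rewrite mulgA -!expgM -expgD expgVn.
Qed.
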